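(* Let $\mathbf{A}$ be a Stonean Hilbert algebra. Then the map $\beta\colon \mathrm{Id}_\alpha(A)\to \mathrm{Od}_\alpha(\mathrm{X}(A))$ defined by $$\beta(I)=\{x\in\mathrm{X}(A)\colon x\cap I\neq\emptyset\}=\bigcup\{\varphi(a)\colon a\in I\}$$ is an isomorphism of Heyting algebras from $\langle \mathrm{Id}_\alpha(A),\sqcup,\sqcap,\twoheadrightarrow,\{0\},A\rangle$ to $\langle \mathrm{Od}_\alpha(\mathrm{X}(A)),\cup,\barwedge,\rightarrowtail,\emptyset,\mathrm{X}(A)\rangle$. Moreover, $$\beta(I)=\bigcup\{(\varphi(a)]\colon \neg\neg a\in I\}$$ for all $I\in\mathrm{Id}_\alpha(A)$.
   Context: A Hilbert algebra is an algebra $\langle A,\to,1\rangle$ of type $(2,0)$ such that for all $a,b,c\in A$: $a\to(b\to a)=1$; $(a\to(b\to c))\to((a\to b)\to(a\to c))=1$; and $a\to b=b\to a=1$ implies $a=b$. Its natural order is: $a\le b$ iff $a\to b=1$. An $H^{\vee}$-algebra is an algebra $\langle A,\to,\vee,1\rangle$ where $\langle A,\to,1\rangle$ is a Hilbert algebra, $\langle A,\vee,1\rangle$ is a join-semilattice with greatest element $1$, and $a\to b=1$ iff $a\vee b=b$ for all $a,b$. An $H_0^{\vee}$-algebra is an $H^{\vee}$-algebra with an element $0$ such that $0\to a=1$ for all $a$; write $\neg a:=a\to 0$. A Stonean Hilbert algebra is an $H_0^{\vee}$-algebra satisfying $\neg a\vee\neg\neg a=1$ for all $a$. An ideal of $\mathbf{A}$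 is a non-empty downset $I\subseteq A$ closed under $\vee$ (so $0\in I$). An ideal $I$ is an $\alpha$-ideal if $a\in I$ implies $\neg\neg a\in I$; $\mathrm{Id}_\alpha(A)$ is the set of $\alpha$-ideals. For $I,J\in\mathrm{Id}_\alpha(A)$: $I\sqcap J:=I\cap J$; $I\sqcup J:=\{x\in A\colon\exists i\in I\,\exists j\in J\ (x\le i\vee j)\}$; $I\twoheadrightarrow J:=\{x\in A\colon\forall i\in I\,\exists j\in J\ (x\le i\to j)\}$. For $\mathbf{A}$ Stonean, $\langle \mathrm{Id}_\alpha(A),\sqcup,\sqcap,\twoheadrightarrow,\{0\},A\rangle$ is known to be a Heyting algebra. An implicative filter of $\mathbf{A}$ is a set $F\subseteq A$ with $1\in F$ such that $a,a\to b\in F$ implies $b\in F$. A proper implicative filter $x$ is irreducible if $x=F_1\cap F_2$ with $F_1,F_2$ implicative filters implies $x=F_1$ or $x=F_2$. $\mathrm{X}(A)$ is the set of irreducible implicative filters, ordered by inclusion. Let $\varphi(a)=\{x\in\mathrm{X}(A)\colon a\in x\}$. The dual space of $\mathbf{A}$ is $\mathrm{X}(A)$ with the topology having base $\mathcal{K}_A=\{\varphi(a)^c\colon a\in A\}$, and $D(\mathrm{X}(A))=\{\varphi(a)\colon a\in A\}$. For $Y\subseteq \mathrm{X}(A)$, $(Y]$ is the downset generated by $Y$. Write $X=\mathrm{X}(A)$. A subset $Y\subseteq X$ is open $\alpha$-directed if there is $B\subseteq D(X)$ with $Y=\bigcup\{(U]\colon U\in B\}$; $\mathrm{Od}_\alpha(X)$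 is the set of all such subsets. For $Y,Z\in\mathrm{Od}_\alpha(X)$: $Y\barwedge Z:=\bigcup\{U\in D(X)\colon U\subseteq Y\cap Z\}$ and $Y\rightarrowtail Z:=\bigcup\{(U]\colon U\in D(X),\ (U]\subseteq Y^c\cup Z\}$. The structure $\langle \mathrm{Od}_\alpha(X),\cup,\barwedge,\rightarrowtail,\emptyset,X\rangle$ is a Heyting algebra. *)

(* Defs.v *)
From HB Require Import structures.
From mathcomp Require Import all_boot.
From mathcomp Require Import boolp classical_sets functions.

Set Implicit Arguments.
Unset Strict Implicit.
Unset Printing Implicit Defensive.

Local Open Scope classical_set_scope.

Declare Scope hilbert_scope.
Delimit Scope hilbert_scope with hilbert.
Local Open Scope hilbert_scope.

Reserved Notation "a ~> b" (at level 55, right associativity).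
Reserved Notation "a \v b" (at level 52, left associativity).
Reserved Notation "a <=h b" (at level 70, no associativity).

HB.mixin Record isHilbertAlgebra A := {
  himp : A -> A -> A;
  hone : A;
  himpK : forall a b, himp a (himp b a) = hone;
  himpS : forall a b c,
    himp (himp a (himp b c)) (himp (himp a b) (himp a c)) = hone;
  himp_anti : forall a b, himp a b = hone -> himp b a = hone -> a = b
}.

#[short(type="hilbertType")]
HB.structure Definition HilbertAlgebra := {A of isHilbertAlgebra A}.

Notation "a ~> b" := (himp a b) : hilbert_scope.

Definition hle (A : hilbertType) (a b : A) : Prop := a ~> b = hone.
Notation "a <=h b" := (hle a b) : hilbert_scope.

HB.mixin Record HilbertAlgebra_isHvee A of HilbertAlgebra A := {
  hjoin : A -> A -> A;
  hjoinA : forall a b c, hjoin a (hjoin b c) = hjoin (hjoin a b) c;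
  hjoinC : forall a b, hjoin a b = hjoin b a;
  hjoinI : forall a, hjoin a a = a;
  hjoin1 : forall a, hjoin a hone = hone;
  himp_hjoin : forall a b, a ~> b = hone <-> hjoin a b = b
}.

#[short(type="hveeType")]
HB.structure Definition HveeAlgebra :=
  {A of HilbertAlgebra A & HilbertAlgebra_isHvee A}.

Notation "a \v b" := (hjoin a b) : hilbert_scope.

HB.mixin Record HveeAlgebra_isH0vee A of HveeAlgebra A := {
  hzero : A;
  hzero_imp : forall a, hzero ~> a = hone
}.

#[short(type="h0veeType")]
HB.structure Definition H0veeAlgebra :=
  {A of HveeAlgebra A & HveeAlgebra_isH0vee A}.

Definition hneg (A : h0veeType) (a : A) : A := a ~> hzero.

HB.mixin Record H0veeAlgebra_isStonean A of H0veeAlgebra A := {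
  stonean : forall a : A, hneg a \v hneg (hneg a) = hone
}.

#[short(type="stoneanHilbertType")]
HB.structure Definition StoneanHilbertAlgebra :=
  {A of H0veeAlgebra A & H0veeAlgebra_isStonean A}.

(* An algebra of Heyting signature whose universe is a subset of an ambient
   type; the operations matter only on that subset, and [heyting_algebra]
   requires it to be closed under them. *)
Record heyting_signature (T : Type) := HeytingSignature {
  hcarrier : set T;
  hsup : T -> T -> T;
  hinf : T -> T -> T;
  hres : T -> T -> T;
  hbot : T;
  htop : T
}.

Record heyting_algebra (T : Type) (H : heyting_signature T) : Prop :=
  HeytingAlgebra {
    hbot_in : hcarrier H (hbot H);
    htop_in : hcarrier H (htop H);
    hsup_in : forall a b,
      hcarrier H a -> hcarrier H b -> hcarrier H (hsup H a b);
    hinf_in : forall a b,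
      hcarrier H a -> hcarrier H b -> hcarrier H (hinf H a b);
    hres_in : forall a b,
      hcarrier H a -> hcarrier H b -> hcarrier H (hres H a b);
    hsupA : forall a b c, hcarrier H a -> hcarrier H b -> hcarrier H c ->
      hsup H a (hsup H b c) = hsup H (hsup H a b) c;
    hinfA : forall a b c, hcarrier H a -> hcarrier H b -> hcarrier H c ->
      hinf H a (hinf H b c) = hinf H (hinf H a b) c;
    hsupC : forall a b, hcarrier H a -> hcarrier H b ->
      hsup H a b = hsup H b a;
    hinfC : forall a b, hcarrier H a -> hcarrier H b ->
      hinf H a b = hinf H b a;
    hsupK : forall a b, hcarrier H a -> hcarrier H b ->
      hinf H a (hsup H a b) = a;
    hinfK : forall a b, hcarrier H a -> hcarrier H b ->
      hsup H a (hinf H a b) = a;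
    hbotP : forall a, hcarrier H a -> hsup H (hbot H) a = a;
    htopP : forall a, hcarrier H a -> hinf H (htop H) a = a;
    (* residuation: a /\ b <= c iff a <= b -> c, where u <= v is u /\ v = u *)
    hresP : forall a b c, hcarrier H a -> hcarrier H b -> hcarrier H c ->
      hinf H (hinf H a b) c = hinf H a b <-> hinf H a (hres H b c) = a
  }.

Record heyting_isomorphism (T U : Type) (H : heyting_signature T)
    (K : heyting_signature U) (f : T -> U) : Prop := HeytingIsomorphism {
  hiso_dom : heyting_algebra H;
  hiso_cod : heyting_algebra K;
  hiso_bij : set_bij (hcarrier H) (hcarrier K) f;
  hiso_sup : forall a b, hcarrier H a -> hcarrier H b ->
    f (hsup H a b) = hsup K (f a) (f b);
  hiso_inf : forall a b, hcarrier H a -> hcarrier H b ->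
    f (hinf H a b) = hinf K (f a) (f b);
  hiso_res : forall a b, hcarrier H a -> hcarrier H b ->
    f (hres H a b) = hres K (f a) (f b);
  hiso_bot : f (hbot H) = hbot K;
  hiso_top : f (htop H) = htop K
}.

Section AlphaIdeals.
Variable A : h0veeType.
Implicit Types I J : set A.

Definition ideal I : Prop :=
  [/\ I !=set0,
      forall a b : A, a <=h b -> I b -> I a &
      forall a b : A, I a -> I b -> I (a \v b)].

Definition alpha_ideal I : Prop :=
  ideal I /\ forall a : A, I a -> I (hneg (hneg a)).

Definition Id_alpha : set (set A) := [set I | alpha_ideal I].

Definition Id_join I J : set A :=
  [set x | exists i j : A, [/\ I i, J j & x <=h i \v j]].

Definition Id_meet I J : set A := I `&` J.

Definition Id_imp I J : set A :=
  [set x | forall i : A, I i -> exists2 j : A, J j & x <=h i ~> j].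

Definition Id_alpha_heyting : heyting_signature (set A) :=
  HeytingSignature Id_alpha Id_join Id_meet Id_imp [set hzero] [set: A].

End AlphaIdeals.

Section DualSpace.
Variable A : hilbertType.

Definition implicative_filter (F : set A) : Prop :=
  F hone /\ forall a b : A, F a -> F (a ~> b) -> F b.

Definition irreducible_filter (x : set A) : Prop :=
  [/\ implicative_filter x,
      x <> setT &
      forall F1 F2 : set A, implicative_filter F1 -> implicative_filter F2 ->
        x = F1 `&` F2 -> x = F1 \/ x = F2].

Definition dual_space : Type := {x : set A | irreducible_filter x}.

Implicit Types (x y : dual_space) (Y Z U : set dual_space).

Definition phi (a : A) : set dual_space := [set x | sval x a].

(* D(X(A)) *)
Definition dual_sets : set (set dual_space) := [set phi a | a in [set: A]].

Definition downset Y : set dual_space :=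
  [set x | exists2 y, Y y & sval x `<=` sval y].

Definition Od_alpha : set (set dual_space) :=
  [set Y | exists2 B : set (set dual_space),
     B `<=` dual_sets & Y = \bigcup_(U in B) downset U].

Definition Od_meet Y Z : set dual_space :=
  \bigcup_(U in [set U | dual_sets U /\ U `<=` Y `&` Z]) U.

Definition Od_imp Y Z : set dual_space :=
  \bigcup_(U in [set U | dual_sets U /\ downset U `<=` ~` Y `|` Z]) downset U.

Definition Od_alpha_heyting : heyting_signature (set dual_space) :=
  HeytingSignature Od_alpha (fun Y Z => Y `|` Z) Od_meet Od_imp
    set0 [set: dual_space].

Definition beta (I : set A) : set dual_space :=
  [set x | sval x `&` I !=set0].

End DualSpace.

Arguments Id_alpha A : clear implicits.
Arguments Id_alpha_heyting A : clear implicits.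
Arguments dual_space A : clear implicits.
Arguments dual_sets A : clear implicits.
Arguments Od_alpha A : clear implicits.
Arguments Od_alpha_heyting A : clear implicits.

(* Main.v *)
Require Import Defs.
From mathcomp Require Import all_boot.
From mathcomp Require Import boolp classical_sets functions.

(** Everything rests on two facts about irreducible filters.

    The first is separation ([separation]): a filter disjoint from an ideal
    extends to an irreducible filter disjoint from that ideal.  Hence an ideal
    [I] is recovered from [beta I] as the set of all [a] with
    [phi a `<=` beta I] ([phi_sub_beta]), and [beta] is injective.

    The second is that irreducible filters are prime for the join, so that in a
    Stonean algebra each of them contains exactly one of [hneg a] and
    [hneg (hneg a)].  It follows that the downset of [phi a] is
    [phi (hneg (hneg a))] ([downset_phi]): extending a filter [x] to an
    irreducible one that contains [a] is possible as soon as [hneg a] is not in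
    [x].  Thus the open alpha-directed sets are the unions of sets
    [phi (hneg (hneg a))], and an ideal is an alpha-ideal iff its image under
    [beta] is a downset.  If [Y] is open alpha-directed, the [a] with
    [phi a `<=` Y] form an alpha-ideal whose image is [Y], so [beta] is onto.

    As for the operations, joins go to unions by primeness.  The double
    negations of two elements of a prime filter have a lower bound in it, namely
    [hneg (hneg a \v hneg b)]; hence [beta] carries intersections to
    intersections, and the meet of open alpha-directed sets is simply their
    intersection.  By separation again, [a] lies in the ideal implication of [I]
    and [J] iff [phi a `&` beta I `<=` beta J], which is the condition that
    defines the implication of open alpha-directed sets.

    Since the lattice operations on open alpha-directed sets are union and
    intersection, the Heyting laws hold there for set-theoretic reasons, and
    they are pulled back along the injection [beta] to the alpha-ideals. *)

Set Implicit Arguments.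
Unset Strict Implicit.
Unset Printing Implicit Defensive.

Local Open Scope classical_set_scope.
Local Open Scope hilbert_scope.

(** * Implicative filters as theories *)

Lemma himp_one (A : hveeType) (a : A) : a ~> hone = hone.
Proof. exact/himp_hjoin/hjoin1. Qed.

Lemma one_filter (A : hveeType) : implicative_filter [set hone : A].
Proof.
split=> // a b /= -> h; apply: himp_anti h; exact: himp_one.
Qed.

(** The implicative filter generated by [F] and [a]; the deduction theorem is
    what makes this set closed under modus ponens. *)
Definition adjoin (A : hilbertType) (F : set A) (a : A) : set A :=
  [set c | F (a ~> c)].

Lemma adjoin_sub (A : hveeType) (F : set A) (a : A) :
  implicative_filter F -> F `<=` adjoin F a.
Proof. by move=> [F1 Fmp] c Fc; apply: Fmp Fc _; rewrite himpK. Qed.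

Lemma adjoin_mem (A : hveeType) (F : set A) (a : A) :
  implicative_filter F -> adjoin F a a.
Proof.
move=> [F1 Fmp]; rewrite /adjoin /=.
(* The combinator identity I = S K K. *)
apply: (Fmp (a ~> (a ~> a))); first by rewrite himpK.
by apply: (Fmp (a ~> ((a ~> a) ~> a))); rewrite ?himpS // himpK.
Qed.

Lemma adjoin_filter (A : hveeType) (F : set A) (a : A) :
  implicative_filter F -> implicative_filter (adjoin F a).
Proof.
move=> [F1 Fmp]; split; first by rewrite /adjoin /= himp_one.
move=> b c /= ab abc; apply: (Fmp _ _ ab); apply: (Fmp _ _ abc).
by rewrite himpS.
Qed.

(** With [hle_filters], this turns inequalities of the algebra into natural
    deduction inside an arbitrary filter. *)
Lemma deduction (A : hveeType) (F : set A) (a b : A) : implicative_filter F ->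
  (forall G, implicative_filter G -> F `<=` G -> G a -> G b) -> F (a ~> b).
Proof.
move=> Ff ab; apply: (ab (adjoin F a)).
- exact: adjoin_filter.
- exact: adjoin_sub.
- exact: adjoin_mem.
Qed.

Lemma hle_filters (A : hveeType) (a b : A) :
  (forall F, implicative_filter F -> F a -> F b) -> a <=h b.
Proof.
move=> ab; apply: (deduction (one_filter A)) => G Gf _; exact: ab.
Qed.

Lemma filter_le (A : hveeType) (F : set A) (a b : A) :
  implicative_filter F -> a <=h b -> F a -> F b.
Proof. by move=> [F1 Fmp] ab Fa; apply: Fmp Fa _; rewrite ab. Qed.

Lemma hle_trans (A : hveeType) (b a c : A) : a <=h b -> b <=h c -> a <=h c.
Proof.
move=> ab bc; apply: hle_filters => F Ff Fa.
exact: (filter_le Ff bc (filter_le Ff ab Fa)).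
Qed.

(** * Joins *)

Lemma hle_joinl (A : hveeType) (a b : A) : a <=h a \v b.
Proof. by apply/himp_hjoin; rewrite hjoinA hjoinI. Qed.

Lemma hle_joinr (A : hveeType) (a b : A) : b <=h a \v b.
Proof. by rewrite hjoinC; exact: hle_joinl. Qed.

Lemma hjoin_le (A : hveeType) (a b c : A) :
  a <=h c -> b <=h c -> a \v b <=h c.
Proof.
by move=> /himp_hjoin ac /himp_hjoin bc; apply/himp_hjoin; rewrite -hjoinA bc.
Qed.

Lemma hjoin_mono (A : hveeType) (a b c d : A) :
  a <=h c -> b <=h d -> a \v b <=h c \v d.
Proof.
move=> ac bd; apply: hjoin_le.
- exact: hle_trans ac (hle_joinl _ _).
- exact: hle_trans bd (hle_joinr _ _).
Qed.

(** The join is only assumed to be a least upper bound; that it eliminates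
    relative to a filter follows because both [a] and [b] lie below the
    second-order encoding [(a ~> c) ~> ((b ~> c) ~> c)] of the disjunction. *)
Lemma filter_join_elim (A : hveeType) (F : set A) (a b c : A) :
  implicative_filter F -> F (a \v b) -> F (a ~> c) -> F (b ~> c) -> F c.
Proof.
move=> Ff Fab Fac Fbc.
have le_u : a \v b <=h (a ~> c) ~> ((b ~> c) ~> c).
  apply: hjoin_le; apply: hle_filters => G Gf Gx;
    apply: deduction => // H Hf GH Hac; apply: deduction => // K Kf HK Kbc.
    by case: Kf => _; apply; [apply: HK; apply: GH; exact: Gx | exact: HK].
  by case: Kf => _; apply; [apply: HK; apply: GH; exact: Gx | exact: Kbc].
have := filter_le Ff le_u Fab; case: Ff => _ Fmp h.
by apply: (Fmp _ _ Fbc); exact: (Fmp _ _ Fac h).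
Qed.

(** By join elimination, [x] is the intersection of the filters obtained by
    adjoining [a] and [b], so irreducibility makes it equal to one of them. *)
Lemma irreducible_prime (A : hveeType) (x : dual_space A) (a b : A) :
  sval x (a \v b) -> sval x a \/ sval x b.
Proof.
case: x => x [xf _ xirr] /= xab.
have /(xirr _ _ (adjoin_filter a xf) (adjoin_filter b xf)) :
    x = adjoin x a `&` adjoin x b.
  rewrite eqEsubset; split=> c; last by case; exact: filter_join_elim.
  by move=> xc; split; exact: adjoin_sub.
by case=> ->; [left | right]; exact: adjoin_mem.
Qed.

Lemma dual_filter (A : hilbertType) (x : dual_space A) :
  implicative_filter (sval x).
Proof. by case: x => x []. Qed.

Lemma phi_join (A : hveeType) (a b : A) : phi (a \v b) = phi a `|` phi b.
Proof.
rewrite eqEsubset; split=> x; first exact: irreducible_prime.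
have xf := dual_filter x.
by case; apply: filter_le => //; [exact: hle_joinl | exact: hle_joinr].
Qed.

(** * Separation of filters from ideals *)

Lemma ideal0 (A : h0veeType) (I : set A) : ideal I -> I hzero.
Proof. by move=> [[a Ia] Idown _]; apply: Idown Ia; exact: hzero_imp. Qed.

Lemma zero_ideal (A : h0veeType) : ideal [set hzero : A].
Proof.
split; first by exists hzero.
- by move=> a b ab /= b0; apply: himp_anti (hzero_imp a); rewrite -b0.
- by move=> a b /= -> ->; rewrite hjoinI.
Qed.

Lemma dual_zero (A : h0veeType) (x : dual_space A) : ~ sval x hzero.
Proof.
case: x => x [xf xT _] /= x0; apply: xT; rewrite -subTset => a _.
exact: (filter_le xf (hzero_imp a) x0).
Qed.

(** A filter that is maximal among those avoiding [I] is irreducible: two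
    strictly larger filters meet [I] in [i] and [j], and then the join of [i]
    and [j] is in [I] and in both of them. *)
Theorem separation (A : h0veeType) (F I : set A) :
  implicative_filter F -> ideal I -> (forall a, F a -> ~ I a) ->
  exists x : dual_space A, F `<=` sval x /\ (forall a, sval x a -> ~ I a).
Proof.
move=> Ff Ii FI.
pose good (X : set A) := implicative_filter X /\ forall a, X a -> ~ I a.
(* Zorn's lemma also asks for the union of the empty chain; taking the union
   with [F] makes that union [F] and builds in the inclusion of [F]. *)
have [C Cchain Ctot | X [[Xf XI] Xmax]] :=
    @Zorn_bigcup A [set X | good (F `|` X)].
  (* Two premises of a modus ponens lie in a single member of the chain. *)
  have common a b : (F `|` \bigcup_(X in C) X) a ->
      (F `|` \bigcup_(X in C) X) b ->
      exists2 X, good (F `|` X) /\ F `|` X `<=` F `|` \bigcup_(X in C) X &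
        (F `|` X) a /\ (F `|` X) b.
    have up X : C X -> F `|` X `<=` F `|` \bigcup_(X in C) X.
      by move=> CX; apply: setUS; exact: bigcup_sup.
    case=> [Fa | [X CX Xa]].
      case=> [Fb | [Y CY Yb]].
        by exists set0; split; rewrite ?setU0 //; apply: subsetUl.
      exists Y; last by split; [left | right].
      by split; [exact: Cchain | exact: up].
    case=> [Fb | [Y CY Yb]].
      exists X; last by split; [right | left].
      by split; [exact: Cchain | exact: up].
    have [XY | YX] := Ctot _ _ CX CY.
      exists Y; last by split; right => //; exact: XY.
      by split; [exact: Cchain | exact: up].
    exists X; last by split; right => //; exact: YX.
    by split; [exact: Cchain | exact: up].
  split; last first.
    by move=> a h; have [X [[_ XI] _] [Xa _]] := common _ _ h h; exact: XI.
  split; first by left; case: Ff.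
  move=> a b ha hb; have [X [[[_ Xmp] _] sub] [Xa Xb]] := common _ _ ha hb.
  by apply: sub; exact: Xmp Xa Xb.
have max G : implicative_filter G -> F `|` X `<=` G -> F `|` X <> G ->
    exists2 i, I i & G i.
  move=> Gf XG nXG; apply: contrapT => /forall2NP GI.
  have FG : F `|` G = G by rewrite setUidr //; apply: subset_trans XG.
  apply: (Xmax G); last first.
    by rewrite /= FG; split=> // a Ga Ia; case: (GI a).
  split; first by apply: subset_trans XG; exact: subsetUr.
  by move=> GX; apply: nXG; rewrite eqEsubset; split=> // a /GX; right.
have irr : irreducible_filter (F `|` X).
  split=> //; first by move=> XT; apply: (XI hzero); rewrite ?XT //;
    exact: ideal0.
  move=> F1 F2 F1f F2f e; apply: contrapT => /not_orP [n1 n2].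
  have [|i Ii1 F1i] := max _ F1f _ n1; first by rewrite e; exact: subIsetl.
  have [|j Ij F2j] := max _ F2f _ n2; first by rewrite e; exact: subIsetr.
  case: Ii => _ _ Ij2; apply: (XI (i \v j)); last exact: Ij2.
  rewrite e; split.
  - exact: filter_le F1f (hle_joinl _ _) F1i.
  - exact: filter_le F2f (hle_joinr _ _) F2j.
by exists (exist _ _ irr); split=> //; exact: subsetUl.
Qed.

(** * Ideals and their images under beta *)

Lemma beta_bigcup (A : hilbertType) (I : set A) :
  beta I = \bigcup_(a in I) phi a.
Proof.
rewrite eqEsubset; split=> x.
- by move=> [a [xa Ia]]; exists a.
- by move=> [a Ia xa]; exists a.
Qed.

(** If [i] in [I] admits no suitable [j], the filter generated by [a] and [i]
    avoids [J], and separation yields a point of [phi a `&` beta I] outside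
    [beta J]. *)
Lemma phi_beta_sub (A : h0veeType) (I J : set A) (a : A) : ideal J ->
  phi a `&` beta I `<=` beta J <->
  (forall i, I i -> exists2 j, J j & a <=h i ~> j).
Proof.
move=> Ji; split=> [aIJ i Ii | aIJ x [xa [i [xi Ii]]]].
  apply: contrapT => /forall2NP nj.
  have Ff := adjoin_filter a (one_filter A).
  have [|x [Gx xJ]] := separation (adjoin_filter i Ff) Ji.
    by move=> j Gj Jj; case: (nj j).
  have xa : sval x a.
    exact: (Gx _ (adjoin_sub i Ff (adjoin_mem a (one_filter A)))).
  have xi : sval x i by exact: (Gx _ (adjoin_mem i Ff)).
  by have [|j [xj Jj]] := aIJ x; [split=> //; exists i | exact: xJ xj Jj].
have [j Jj aij] := aIJ i Ii; exists j; split=> //.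
have [_ mp] := dual_filter x; apply: mp xi _.
exact: filter_le (dual_filter x) aij xa.
Qed.

(** Being a member of an ideal can be read off its image; this gives the
    injectivity of [beta]. *)
Lemma phi_sub_beta (A : h0veeType) (I : set A) (a : A) : ideal I ->
  phi a `<=` beta I <-> I a.
Proof.
move=> Ii; split=> [aI | Ia x xa]; last by exists a.
(* Contraction: for the ideal [I] and the singleton of [a], the criterion gives
   [a <=h a ~> j] with [j] in [I], that is, [a <=h j]. *)
have [|j Ij aaj] := (phi_beta_sub [set a] a Ii).1 _ a erefl.
  by move=> x [xa _]; exact: aI.
case: Ii => _ Idown _; apply: Idown Ij.
apply: hle_filters => F Ff Fa; have := filter_le Ff aaj Fa.
by case: Ff => _ Fmp; exact: Fmp.
Qed.

Lemma beta_join (A : h0veeType) (I J : set A) : ideal I -> ideal J ->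
  beta (Id_join I J) = beta I `|` beta J.
Proof.
move=> Ii Ji; rewrite eqEsubset; split=> x.
  move=> [a [xa [i [j [Ii' Jj aij]]]]].
  have := filter_le (dual_filter x) aij xa.
  by move=> /irreducible_prime[xi | xj]; [left; exists i | right; exists j].
case=> [[i [xi Ii']] | [j [xj Jj]]].
- exists i; split=> //; exists i, hzero; split=> //; first exact: ideal0.
  exact: hle_joinl.
- exists j; split=> //; exists hzero, j; split=> //; first exact: ideal0.
  exact: hle_joinr.
Qed.

Lemma ideal_join (A : h0veeType) (I J : set A) : ideal I -> ideal J ->
  ideal (Id_join I J).
Proof.
move=> Ii Ji; split.
- exists hzero, hzero, hzero; split; try exact: ideal0.
  exact: hzero_imp.
- move=> a b ab [i [j [Ii' Jj bij]]]; exists i, j; split=> //.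
  exact: hle_trans ab bij.
- move=> a b [i [j [Ii1 Jj ha]]] [k [l [Ik Jl hb]]].
  case: Ii Ji => _ _ Iv [_ _ Jv].
  exists (i \v k), (j \v l); split; [exact: Iv | exact: Jv |].
  apply: hjoin_le.
  + by apply: hle_trans ha _; apply: hjoin_mono; exact: hle_joinl.
  + by apply: hle_trans hb _; apply: hjoin_mono; exact: hle_joinr.
Qed.

Lemma ideal_meet (A : h0veeType) (I J : set A) : ideal I -> ideal J ->
  ideal (Id_meet I J).
Proof.
move=> Ii Ji; split; first by exists hzero; split; exact: ideal0.
- case: Ii Ji => _ Id _ [_ Jd _] a b ab [Ib Jb].
  by split; [exact: Id ab _ | exact: Jd ab _].
- case: Ii Ji => _ _ Iv [_ _ Jv] a b [Ia Ja] [Ib Jb].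
  by split; [exact: Iv | exact: Jv].
Qed.

Lemma ideal_imp (A : h0veeType) (I J : set A) : ideal J ->
  ideal (Id_imp I J).
Proof.
move=> Ji; split.
- by exists hzero => i _; exists hzero; [exact: ideal0 | exact: hzero_imp].
- by move=> a b ab Hb i /Hb[j Jj bij]; exists j => //; exact: hle_trans bij.
- move=> a b /(phi_beta_sub _ _ Ji) Ha /(phi_beta_sub _ _ Ji) Hb.
  by apply/(phi_beta_sub _ _ Ji); rewrite phi_join setIUl subUset.
Qed.

(** * Double negation and downsets *)

Lemma hneg2_imp (A : h0veeType) (a b : A) :
  hneg (hneg (a ~> b)) <=h a ~> hneg (hneg b).
Proof.
apply: hle_filters => F Ff Fab; apply: deduction => // G Gf FG Ga.
apply: deduction => // H Hf GH Hb; case: (Hf) => _ Hmp.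
apply: Hmp _ (GH _ (FG _ Fab)); apply: deduction => // K Kf HK Kab.
have [_ Kmp] := Kf.
exact: Kmp (Kmp _ _ (HK _ (GH _ Ga)) Kab) (HK _ Hb).
Qed.

Lemma hneg2_mono (A : h0veeType) (a b : A) :
  a <=h b -> hneg (hneg a) <=h hneg (hneg b).
Proof.
move=> ab; apply: hle_filters => F Ff Fa.
apply: deduction => // G Gf FG Gb; case: (Gf) => _ Gmp.
apply: Gmp _ (FG _ Fa); apply: deduction => // H Hf GH Ha.
case: (Hf) => _ Hmp; apply: Hmp (GH _ Gb); exact: filter_le ab Ha.
Qed.

Lemma hle_hneg2 (A : h0veeType) (a : A) : a <=h hneg (hneg a).
Proof.
apply: hle_filters => F Ff Fa; apply: deduction => // G [_ Gmp] FG Gn.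
exact: Gmp (FG _ Fa) Gn.
Qed.

(** An irreducible filter decides every negation, by primeness applied to the
    Stone identity. *)
Lemma dual_hneg2 (A : stoneanHilbertType) (x : dual_space A) (a : A) :
  sval x (hneg (hneg a)) <-> ~ sval x (hneg a).
Proof.
have [x1 xmp] := dual_filter x; split.
- move=> xnn xn; apply: (@dual_zero _ x); exact: xmp xn xnn.
- move=> xn; have /irreducible_prime[] // : sval x (hneg a \v hneg (hneg a)).
  by rewrite stonean.
Qed.

(** The filters below a point of [phi a] are those with which [a] is consistent,
    that is, those that do not contain [hneg a]. *)
Lemma downset_phi (A : stoneanHilbertType) (a : A) :
  downset (phi a) = phi (hneg (hneg a)).
Proof.
rewrite eqEsubset; split=> x.
  move=> [y ya xy]; apply/dual_hneg2 => xn; apply: (@dual_zero _ y).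
  by have [_ ymp] := dual_filter y; exact: ymp ya (xy _ xn).
move=> /dual_hneg2 xn; have xf := dual_filter x.
have [|y [xay _]] := separation (adjoin_filter a xf) (zero_ideal A).
  by move=> b xb /= b0; apply: xn; rewrite /hneg -b0.
exists y; first exact: (xay _ (adjoin_mem a xf)).
exact: subset_trans (adjoin_sub a xf) xay.
Qed.

Lemma downset_hneg2 (A : stoneanHilbertType) (Y : set (dual_space A)) (a : A) :
  downset Y `<=` Y -> phi a `<=` Y -> phi (hneg (hneg a)) `<=` Y.
Proof.
move=> Yd aY; rewrite -downset_phi => x [y ya xy].
by apply: Yd; exists y => //; exact: aY.
Qed.

(** An ideal contains [hneg (hneg a)] iff its image contains
    [phi (hneg (hneg a))], which is the downset of [phi a]. *)
Lemma alpha_idealP (A : stoneanHilbertType) (I : set A) : ideal I ->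
  alpha_ideal I <-> downset (beta I) `<=` beta I.
Proof.
move=> Ii; split=> [[_ Ia] x [y [a [ya Iya]] xy] | Id].
  exists (hneg (hneg a)); split; last exact: Ia.
  by have : downset (phi a) x by [exists y]; rewrite downset_phi.
split=> // a /(phi_sub_beta _ Ii) aI; apply/(phi_sub_beta _ Ii).
exact: downset_hneg2.
Qed.

(** The regular elements of a Stonean algebra have meets, and prime filters see
    them: a filter containing [hneg (hneg i)] and [hneg (hneg j)] refutes
    [hneg i \v hneg j] by join elimination. *)
Lemma beta_meet (A : stoneanHilbertType) (I J : set A) :
  alpha_ideal I -> alpha_ideal J ->
  beta (Id_meet I J) = beta I `&` beta J.
Proof.
move=> [[_ Id _] Ia] [[_ Jd _] Ja]; rewrite eqEsubset; split=> x.
  by move=> [a [xa [Iia Jja]]]; split; exists a.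
move=> [[i [xi Ii]] [j [xj Jj]]].
have xf := dual_filter x; exists (hneg (hneg i \v hneg j)); split.
  apply: deduction => // G Gf xG Gij; apply: (filter_join_elim Gf Gij).
  - exact/xG/(filter_le xf (hle_hneg2 i)).
  - exact/xG/(filter_le xf (hle_hneg2 j)).
have anti (p q : A) : p <=h q -> hneg q <=h hneg p.
  move=> pq; apply: hle_filters => F Ff Fq.
  apply: deduction => // G Gf FG Gp; case: (Gf) => _ Gmp.
  exact: Gmp (filter_le Gf pq Gp) (FG _ Fq).
split.
- by apply: Id (Ia _ Ii); apply/anti/hle_joinl.
- by apply: Jd (Ja _ Jj); apply/anti/hle_joinr.
Qed.

(** The double negation of an element below [i \v j] is handled through images:
    a union of downsets is a downset. *)
Lemma Id_alpha_join (A : stoneanHilbertType) (I J : set A) :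
  alpha_ideal I -> alpha_ideal J -> alpha_ideal (Id_join I J).
Proof.
move=> Ia Ja; have [Ii _] := Ia; have [Ji _] := Ja.
apply/(alpha_idealP (ideal_join Ii Ji)); rewrite beta_join //.
move: Ia Ja => /(alpha_idealP Ii) Id /(alpha_idealP Ji) Jd x [y [yI | yJ] xy].
- by left; apply: Id; exists y.
- by right; apply: Jd; exists y.
Qed.

Lemma Id_alpha_meet (A : h0veeType) (I J : set A) :
  alpha_ideal I -> alpha_ideal J -> alpha_ideal (Id_meet I J).
Proof.
move=> [Ii Ia] [Ji Ja]; split; first exact: ideal_meet.
by move=> a [Iia Jja]; split; [exact: Ia | exact: Ja].
Qed.

Lemma Id_alpha_imp (A : h0veeType) (I J : set A) :
  alpha_ideal J -> alpha_ideal (Id_imp I J).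
Proof.
move=> [Ji Ja]; split; first exact: ideal_imp.
move=> a aIJ i /aIJ[j Jj aij]; exists (hneg (hneg j)); first exact: Ja.
exact: hle_trans (hneg2_mono aij) (hneg2_imp _ _).
Qed.

Lemma Id_alpha_bot (A : h0veeType) : alpha_ideal [set hzero : A].
Proof.
split; first exact: zero_ideal.
move=> a /= ->; apply: himp_anti (hzero_imp _).
apply: hle_filters => F [F1 Fmp] F00; apply: Fmp _ F00.
by rewrite /hneg hzero_imp.
Qed.

Lemma Id_alpha_top (A : h0veeType) : alpha_ideal [set: A].
Proof. by split=> //; split=> //; exists hzero. Qed.

(** * Open alpha-directed sets *)

Lemma downset_idem (A : hilbertType) (Y : set (dual_space A)) :
  downset (downset Y) `<=` downset Y.
Proof.
by move=> x [y [z Yz yz] xy]; exists z => //; exact: subset_trans yz.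
Qed.

Lemma Od_alpha_downset (A : hilbertType) (Y : set (dual_space A)) :
  Od_alpha A Y -> downset Y `<=` Y.
Proof.
move=> [B _ ->] x [y [U BU yU] xy]; exists U => //.
by apply: downset_idem; exists y.
Qed.

Lemma beta_hneg2 (A : stoneanHilbertType) (I : set A) : Id_alpha A I ->
  beta I = \bigcup_(a in [set a : A | I (hneg (hneg a))]) downset (phi a).
Proof.
move=> [[_ Id _] Ia]; rewrite beta_bigcup eqEsubset; split=> x [a Ia' xa].
- exists a; first exact: Ia.
  by rewrite downset_phi; exact: filter_le (dual_filter x) (hle_hneg2 a) xa.
- by rewrite downset_phi in xa; exists (hneg (hneg a)).
Qed.

Lemma beta_Od_alpha (A : stoneanHilbertType) (I : set A) :
  Id_alpha A I -> Od_alpha A (beta I).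
Proof.
move=> Ia; exists (@phi A @` [set a : A | I (hneg (hneg a))]).
- by move=> _ [a _ <-]; exists a.
- by rewrite bigcup_image beta_hneg2.
Qed.

(** The preimage of [Y] is the largest candidate, all [a] with [phi a `<=` Y].
    It covers [Y] because each generating downset of [Y] is itself of the form
    [phi (hneg (hneg a))]. *)
Lemma beta_surj (A : stoneanHilbertType) (Y : set (dual_space A)) :
  Od_alpha A Y -> exists2 I, Id_alpha A I & beta I = Y.
Proof.
move=> Yod; have Yd := Od_alpha_downset Yod.
exists [set a | phi a `<=` Y]; last first.
  rewrite beta_bigcup eqEsubset; split=> x;
    first by move=> [a aY xa]; exact: aY.
  case: Yod (Yd) => B BD YE _.
  rewrite {1}YE => -[U BU]; have [a _ aU] := BD U BU; rewrite -aU downset_phi.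
  move=> xa; exists (hneg (hneg a)) => //=.
  rewrite -downset_phi aU YE; exact: (bigcup_sup BU).
split; last by move=> a; exact: downset_hneg2.
split.
- by exists hzero => x /dual_zero.
- by move=> a b ab /= bY x xa; apply/bY/(filter_le (dual_filter x) ab xa).
- by move=> a b /= aY bY; rewrite phi_join subUset.
Qed.

Lemma beta_inj (A : h0veeType) (I J : set A) :
  ideal I -> ideal J -> beta I = beta J -> I = J.
Proof.
move=> Ii Ji IJ; rewrite eqEsubset.
by split=> a; move=> /phi_sub_beta h; apply/phi_sub_beta => //;
  [rewrite -IJ | rewrite IJ]; exact: h.
Qed.

Lemma Od_meetE (A : stoneanHilbertType) (Y Z : set (dual_space A)) :
  Od_alpha A Y -> Od_alpha A Z -> Od_meet Y Z = Y `&` Z.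
Proof.
move=> /beta_surj[I Ia <-] /beta_surj[J Ja <-].
rewrite eqEsubset; split=> x; first by move=> [U [_ UIJ]]; exact: UIJ.
rewrite -beta_meet // => -[a [xa IJa]]; exists (phi a) => //.
by split; [exists a | move=> y ya; rewrite -beta_meet //; exists a].
Qed.

(** The condition on [a] in [Od_imp] bears on the whole downset of [phi a].  It
    follows from [phi a `&` beta I `<=` beta J] because [beta J] is a downset:
    a filter below a point of [phi a] passes its member of [I] on to that
    point. *)
Lemma beta_imp (A : stoneanHilbertType) (I J : set A) :
  Id_alpha A J -> beta (Id_imp I J) = Od_imp (beta I) (beta J).
Proof.
move=> Ja; have [Ji _] := Ja.
have Jd := (alpha_idealP Ji).1 Ja.
rewrite eqEsubset; split=> x.
  move=> [a [xa aIJ]]; exists (phi a); last by exists x.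
  split; first by exists a.
  move=> y [z za yz]; have [yI | yI] := pselect (beta I y); last by left.
  right; apply: Jd; exists z => //; apply: (phi_beta_sub _ _ Ji).2 aIJ _ _.
  by split=> //; case: yI => i [yi Ii]; exists i; split=> //; exact: yz.
move=> [_ [[a _ <-] aIJ] xa].
have aimp : Id_imp I J a.
  apply/(phi_beta_sub _ _ Ji) => y [ya yI].
  by have [||//] := aIJ y; first by exists y.
have impa := Id_alpha_imp I Ja; have [impi _] := impa.
apply: ((alpha_idealP impi).1 impa).
by case: xa => y ya xy; exists y => //; exists a.
Qed.

Lemma Od_alpha_imp (A : hilbertType) (Y Z : set (dual_space A)) :
  Od_alpha A (Od_imp Y Z).
Proof.
by exists [set U | dual_sets A U /\ downset U `<=` ~` Y `|` Z] => // U [].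
Qed.

Lemma Od_alpha_meet (A : stoneanHilbertType) (Y Z : set (dual_space A)) :
  Od_alpha A Y -> Od_alpha A Z -> Od_alpha A (Y `&` Z).
Proof.
move=> /beta_surj[I Ia <-] /beta_surj[J Ja <-]; rewrite -beta_meet //.
exact/beta_Od_alpha/Id_alpha_meet.
Qed.

Lemma Od_alpha_union (A : hilbertType) (Y Z : set (dual_space A)) :
  Od_alpha A Y -> Od_alpha A Z -> Od_alpha A (Y `|` Z).
Proof.
move=> [B BD ->] [C CD ->]; exists (B `|` C); last by rewrite bigcup_setU.
by rewrite subUset.
Qed.

(** [Od_imp Z W] is the union of the generators contained in [~` Z `|` W], and
    [Y] is a union of generators; so this is residuation for sets. *)
Lemma Od_imp_residual (A : hilbertType) (Y Z W : set (dual_space A)) :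
  Od_alpha A Y -> Y `&` Z `<=` W <-> Y `<=` Od_imp Z W.
Proof.
move=> [B BD ->]; split=> [YZW x [U BU xU] | YZW x [Yx Zx]].
  exists U => //; split; first exact: BD.
  move=> y yU; have [Zy | Zy] := pselect (Z y); last by left.
  by right; apply: YZW; split=> //; exists U.
by have [U [_ UZW] /UZW[]] := YZW _ Yx.
Qed.

Lemma beta_top (A : h0veeType) : beta [set: A] = [set: dual_space A].
Proof.
rewrite eqEsubset; split=> // x _; exists hone; split=> //.
by have [] := dual_filter x.
Qed.

Lemma beta_bot (A : h0veeType) : beta [set hzero : A] = set0.
Proof.
by rewrite -subset0 => x [a [xa a0]]; apply: (@dual_zero _ x); rewrite -a0.
Qed.

(** * The Heyting algebra laws *)

Lemma Od_alpha_heytingP (A : stoneanHilbertType) :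
  heyting_algebra (Od_alpha_heyting A).
Proof.
have I2 := @Od_alpha_meet A; have U2 := @Od_alpha_union A.
have R2 := @Od_alpha_imp A.
have T : Od_alpha A setT.
  by rewrite -beta_top; apply/beta_Od_alpha/Id_alpha_top.
split=> /=.
- by rewrite -beta_bot; apply/beta_Od_alpha/Id_alpha_bot.
- exact: T.
- by [].
- by move=> Y Z Yo Zo; rewrite Od_meetE //; exact: I2.
- by [].
- by move=> *; exact: setUA.
- move=> Y Z W Yo Zo Wo; have YZ := I2 _ _ Yo Zo; have ZW := I2 _ _ Zo Wo.
  by rewrite (Od_meetE Yo Zo) (Od_meetE Zo Wo) !Od_meetE // setIA.
- by move=> *; exact: setUC.
- by move=> Y Z Yo Zo; rewrite !Od_meetE // setIC.
- by move=> Y Z Yo Zo; rewrite setUC Od_meetE ?setKU //; exact: U2.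
- by move=> Y Z Yo Zo; rewrite Od_meetE // setIC setKI.
- by move=> Y _; exact: set0U.
- by move=> Y Yo; rewrite Od_meetE // setTI.
- move=> Y Z W Yo Zo Wo; have YZ := I2 _ _ Yo Zo.
  rewrite (Od_meetE Yo Zo) !Od_meetE //.
  split=> [/setIidPl | /setIidPl] h; apply/setIidPl; exact/Od_imp_residual.
Qed.

(** Every law of a Heyting algebra is an equation or, for residuation, an
    equivalence between two equations, so all of them are reflected by an
    injection that preserves the operations. *)
Lemma heyting_algebra_inj (T U : Type) (H : heyting_signature T)
    (K : heyting_signature U) (f : T -> U) :
  heyting_algebra K ->
  (forall a, hcarrier H a -> hcarrier K (f a)) ->
  (forall a b, hcarrier H a -> hcarrier H b -> f a = f b -> a = b) ->
  hcarrier H (hbot H) -> hcarrier H (htop H) ->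
  (forall a b, hcarrier H a -> hcarrier H b -> hcarrier H (hsup H a b)) ->
  (forall a b, hcarrier H a -> hcarrier H b -> hcarrier H (hinf H a b)) ->
  (forall a b, hcarrier H a -> hcarrier H b -> hcarrier H (hres H a b)) ->
  f (hbot H) = hbot K -> f (htop H) = htop K ->
  (forall a b, hcarrier H a -> hcarrier H b ->
     f (hsup H a b) = hsup K (f a) (f b)) ->
  (forall a b, hcarrier H a -> hcarrier H b ->
     f (hinf H a b) = hinf K (f a) (f b)) ->
  (forall a b, hcarrier H a -> hcarrier H b ->
     f (hres H a b) = hres K (f a) (f b)) ->
  heyting_algebra H.
Proof.
move=> Kh fK finj b_in t_in s_in i_in r_in fb ft fs fi fr.
split=> //.
- move=> a b c Ha Hb Hc; apply: finj; auto; rewrite !fs; auto.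
  by apply: (hsupA Kh); auto.
- move=> a b c Ha Hb Hc; apply: finj; auto; rewrite !fi; auto.
  by apply: (hinfA Kh); auto.
- move=> a b Ha Hb; apply: finj; auto; rewrite !fs; auto.
  by apply: (hsupC Kh); auto.
- move=> a b Ha Hb; apply: finj; auto; rewrite !fi; auto.
  by apply: (hinfC Kh); auto.
- move=> a b Ha Hb; apply: finj; auto; rewrite fi ?fs; auto.
  by apply: (hsupK Kh); auto.
- move=> a b Ha Hb; apply: finj; auto; rewrite fs ?fi; auto.
  by apply: (hinfK Kh); auto.
- move=> a Ha; apply: finj; auto; rewrite fs ?fb; auto.
  by apply: (hbotP Kh); auto.
- move=> a Ha; apply: finj; auto; rewrite fi ?ft; auto.
  by apply: (htopP Kh); auto.
- move=> a b c Ha Hb Hc.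
  have := hresP Kh (fK _ Ha) (fK _ Hb) (fK _ Hc).
  rewrite -fr // -!fi //; auto; move=> [h1 h2].
  split=> e; apply: finj; auto; [apply: h1 | apply: h2]; by rewrite e.
Qed.

Theorem theorem6p10 (A : stoneanHilbertType) :
  [/\ forall I : set A, Id_alpha A I -> beta I = \bigcup_(a in I) phi a,
      heyting_isomorphism (Id_alpha_heyting A) (Od_alpha_heyting A)
        (fun I : set A => beta I) &
      forall I : set A, Id_alpha A I ->
        beta I = \bigcup_(a in [set a : A | I (hneg (hneg a))])
                   downset (phi a)].
Proof.
split; [by move=> I _; exact: beta_bigcup | | exact: beta_hneg2].
have sup I J : Id_alpha A I -> Id_alpha A J ->
    beta (Id_join I J) = beta I `|` beta J.
  by move=> [Ii _] [Ji _]; exact: beta_join.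
have inf I J : Id_alpha A I -> Id_alpha A J ->
    beta (Id_meet I J) = Od_meet (beta I) (beta J).
  by move=> Ia Ja; rewrite Od_meetE ?beta_meet //; exact: beta_Od_alpha.
have inj I J : Id_alpha A I -> Id_alpha A J -> beta I = beta J -> I = J.
  by move=> [Ii _] [Ji _]; exact: beta_inj.
have Oh := Od_alpha_heytingP A.
split=> //=.
- apply: (heyting_algebra_inj Oh (f := fun I : set A => beta I)) => //=.
  + exact: beta_Od_alpha.
  + exact: Id_alpha_bot.
  + exact: Id_alpha_top.
  + exact: Id_alpha_join.
  + exact: Id_alpha_meet.
  + by move=> I J _; exact: Id_alpha_imp.
  + exact: beta_bot.
  + exact: beta_top.
  + by move=> I J _; exact: beta_imp.
- split; first by move=> I; exact: beta_Od_alpha.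
  + by move=> I J /set_mem Ia /set_mem Ja; exact: inj.
  + by move=> Y /beta_surj.
- by move=> I J _; exact: beta_imp.
- exact: beta_bot.
- exact: beta_top.
Qed.
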